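(* Consider the three-stakeholder (RG, HP, AS) sizing game described in the context, with decision vectors $\bm{x}^{k}$, cost functions $C^{k}$, private equality constraints $\bm{h}^{k}(\bm{x}^{k})=\bm{0}$ and private inequality constraints $\bm{g}^{k}(\bm{x}^{k})\le\bm{0}$ for $k\in\{\text{rg},\text{hp},\text{as}\}$, and with the market-clearing coupling constraints $$P_t^{\text{rg,sell,hp}}-P_t^{\text{hp,buy,rg}}=0,\quad P_t^{\text{rg,sell,as}}-P_t^{\text{as,buy,rg}}=0,\quad f_t^{\text{hp,sell,as}}-f_t^{\text{as,buy,hp}}=0\qquad\text{for all }t .$$ Then the variational equilibrium (VE) of the game is equivalent to the optimal solution of the single optimization problem $$\min_{\bm{x}^{\text{rg}},\bm{x}^{\text{hp}},\bm{x}^{\text{as}}}\ \sum_{k\in\{\text{rg},\text{hp},\text{as}\}}C^{k}\quad\text{s.t.}\quad \bm{h}^{k}(\bm{x}^{k})=\bm{0}:\bm{\mu}^{k},\ \ \bm{g}^{k}(\bm{x}^{k})\le\bm{0}:\bm{\lambda}^{k}\ \ \forall k,\ \text{ and the three coupling constraints}: \bm{\rho}^{\text{rg-hp,e}},\bm{\rho}^{\text{rg-as,e}},\bm{\rho}^{\text{hp-as,h}},$$ where the symbols after the colons are the dual variables, and the trading prices occurring in the $C^{k}$ are $\bm{\rho}^{\text{rg-hp,e}},\bm{\rho}^{\text{rg-as,e}},\bm{\rho}^{\text{hp-as,h}}$, common to all stakeholders. That is, a tuple $\big((\bm{x}^{k},\bm{\lambda}^{k},\bm{\mu}^{k})_{k},\bm{\rho}^{\text{rg-hp,e}},\bm{\rho}^{\text{rg-as,e}},\bm{\rho}^{\text{hp-as,h}}\big)$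 is a VE of the game if and only if $(\bm{x}^{\text{rg}},\bm{x}^{\text{hp}},\bm{x}^{\text{as}})$ is an optimal solution of this problem with associated dual variables $(\bm{\lambda}^{k},\bm{\mu}^{k})_{k},\bm{\rho}^{\text{rg-hp,e}},\bm{\rho}^{\text{rg-as,e}},\bm{\rho}^{\text{hp-as,h}}$.
   Context: **Setting.** An off-grid renewable-power-to-ammonia system with three stakeholders $k\in\{\text{rg},\text{hp},\text{as}\}$ (renewable generation, hydrogen production, ammonia synthesis). Time steps are $t=1,\dots,T$ of length $\Delta t>0$. The horizon $T$ is split into consecutive operational horizons of length $\tau$. Time-indexed constraints hold for all $t$ for which the quantities involved are defined (initial states at $t=0$ are included). Bars above/below denote given upper/lower bounds. All lower-case coefficients $c,\eta,\zeta,\sigma,r,x,K$ are given constants: efficiencies, conversion coefficients and Weymouth constants $K$ are positive, and $\underline\pi_m\ge0$. The capacities $W^{\text{rg,wt}},W^{\text{rg,pv}}$, the maximum wind/PV powers $P_t^{\text{rg,wt,max}},P_t^{\text{rg,pv,max}}$, the ammonia price $\rho_t^{\text{a}}$, the backup power price $\rho_t^{\text{as,back}}$, and the line and pipeline costs $C^{\text{rg,line}},C^{\text{hp,pipe}}$ are data. A slash in a superscript means the statement holds for each alternative. The vector $\bm{x}^{k}$ collects all variables (not data, not prices) occurring in the constraints of stakeholder $k$ below; the three vectors have no common components. $\bm{h}^k=\bm{0}$ and $\bm{g}^k\le\bm{0}$ collect all the equality and inequality constraints of stakeholder $k$ listed below. **RG constraints** ($\bm{h}^{\text{rg}},\bm{g}^{\text{rg}}$).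 Capacities: $\underline W^{\text{rg,bes}}\le W^{\text{rg,bes}}\le\overline W^{\text{rg,bes}}$ and $\underline W^{\text{rg,vc}}\le W^{\text{rg,vc}}\le\overline W^{\text{rg,vc}}$. Battery (BES): $\|(P_t^{\text{rg,bes,c/d}},Q_t^{\text{rg,bes}})\|_2\le W^{\text{rg,bes}}$; $0\le P_t^{\text{rg,bes,c}},P_t^{\text{rg,bes,d}}\le 0.5W^{\text{rg,bes}}$; $S_t^{\text{rg,bes}}=(1-\zeta^{\text{bes}})S_{t-1}^{\text{rg,bes}}+(\eta^{\text{bes,c}}P_t^{\text{rg,bes,c}}-P_t^{\text{rg,bes,d}}/\eta^{\text{bes,d}})\Delta t$; initial state equals final state over each operational horizon ($S_{t=0}^{\text{rg,bes}}=S_{t=\tau}^{\text{rg,bes}}$); $\underline\eta^{\text{bes}}W^{\text{rg,bes}}\le S_t^{\text{rg,bes}}\le\overline\eta^{\text{bes}}W^{\text{rg,bes}}$. Power flow on a radial directed network (each bus has at most one incoming branch), branches $ij$: $\sum_{j':j\to j'}P_{jj',t}=p_{j,t}+\sum_{i:i\to j}(P_{ij,t}-r_{ij}\ell_{ij,t})$; $\sum_{j':j\to j'}Q_{jj',t}=q_{j,t}+\sum_{i:i\to j}(Q_{ij,t}-x_{ij}\ell_{ij,t})$; $\upsilon_{j,t}=\upsilon_{i,t}-2r_{ij}P_{ij,t}-2x_{ij}Q_{ij,t}+(r_{ij}^2+x_{ij}^2)\ell_{ij,t}$; $\|(2P_{ij,t},2Q_{ij,t},\ell_{ij,t}-\upsilon_{i,t})\|_2\le\ell_{ij,t}+\upsilon_{i,t}$;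 $\underline\upsilon_i\le\upsilon_{i,t}\le\overline\upsilon_i$; $\ell_{ij,t}\le\overline\ell_{ij}$. Injections at bus $i$ (a term with bus index $i$ is the corresponding quantity if that facility or sale is located at bus $i$, and $0$ otherwise): $p_{i,t}=P_{i,t}^{\text{rg,wt}}+P_{i,t}^{\text{rg,pv}}+P_{i,t}^{\text{rg,bes,d}}-P_{i,t}^{\text{rg,bes,c}}-P_{i,t}^{\text{rg,sell,hp}}-P_{i,t}^{\text{rg,sell,as}}$; $q_{i,t}=Q_{i,t}^{\text{rg,wt}}+Q_{i,t}^{\text{rg,pv}}+Q_{i,t}^{\text{rg,vc}}+Q_{i,t}^{\text{rg,bes}}$. Sources: $P_t^{\text{rg,wt/pv}}=P_t^{\text{rg,wt/pv,max}}-P_t^{\text{rg,wt/pv,curt}}$; $\|(P_t^{\text{rg,wt/pv}},Q_t^{\text{rg,wt/pv}})\|_2\le W^{\text{rg,wt/pv}}$; $|Q_t^{\text{rg,vc}}|\le W^{\text{rg,vc}}$. **HP constraints** ($\bm{h}^{\text{hp}},\bm{g}^{\text{hp}}$). Capacities: $\underline W^{\text{hp,ae}}\le W^{\text{hp,ae}}\le\overline W^{\text{hp,ae}}$, $\underline W^{\text{hp,hst}}\le W^{\text{hp,hst}}\le\overline W^{\text{hp,hst}}$, $\underline W^{\text{hp,bes}}\le W^{\text{hp,bes}}\le\overline W^{\text{hp,bes}}$. The battery constraints of RG with superscript rg replaced by hp. Hydrogen production: $f_t^{\text{hp,pro}}=P_t^{\text{hp,ae}}\eta^{\text{p2h}}$;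 $\underline\eta^{\text{ae}}W^{\text{hp,ae}}\le P_t^{\text{hp,ae}}\le\overline\eta^{\text{ae}}W^{\text{hp,ae}}$; $P_t^{\text{hp,comp}}=f_t^{\text{hp,pro}}\eta^{\text{hp,comp}}$; $P_t^{\text{hp,buy,rg}}+P_t^{\text{hp,bes,d}}=P_t^{\text{hp,bes,c}}+P_t^{\text{hp,ae}}+P_t^{\text{hp,comp}}$. Hydrogen storage: $S_{t+1}^{\text{hp,hst}}=S_t^{\text{hp,hst}}+(f_t^{\text{hp,hst,in}}-f_t^{\text{hp,hst,out}})\Delta t$; $S_{t=0}^{\text{hp,hst}}=S_{t=T}^{\text{hp,hst}}$; $\underline\eta^{\text{hst}}W^{\text{hp,hst}}\le S_t^{\text{hp,hst}}\le\overline\eta^{\text{hst}}W^{\text{hp,hst}}$; $0\le f_t^{\text{hp,hst,in}},f_t^{\text{hp,hst,out}}\le0.5W^{\text{hp,hst}}$. Hydrogen pipeline $mn$ from node $m$ to node $n$: $(F_{mn,t}/K_{mn}^{\text{gf}})^2\le\pi_{m,t}^2-\pi_{n,t}^2$; $F_{mn,t}=(F_{mn,t}^{\text{in}}+F_{mn,t}^{\text{out}})/2$; $F_{mn,t}\ge0$; $\underline\pi_m\le\pi_{m,t}\le\overline\pi_m$ and likewise at $n$; $LP_{mn,t}=K_{mn}^{\text{lp}}(\pi_{m,t}+\pi_{n,t})/2$; $LP_{mn,t+1}=LP_{mn,t}+F_{mn,t}^{\text{in}}-F_{mn,t}^{\text{out}}$; initial linepack equals final linepack over each operational horizon ($LP_{mn,t=0}=LP_{mn,t=\tau}$);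 $f_t^{\text{hp,pro}}+f_t^{\text{hp,hst,out}}-f_t^{\text{hp,hst,in}}+F_{mn,t}^{\text{out}}-F_{mn,t}^{\text{in}}=f_t^{\text{hp,sell,as}}$. **AS constraints** ($\bm{h}^{\text{as}},\bm{g}^{\text{as}}$). Capacities: $\underline W^{\text{as,asy}}\le W^{\text{as,asy}}\le\overline W^{\text{as,asy}}$, $\underline W^{\text{as,ast}}\le W^{\text{as,ast}}\le\overline W^{\text{as,ast}}$, $\underline W^{\text{as,hst}}\le W^{\text{as,hst}}\le\overline W^{\text{as,hst}}$. The hydrogen storage constraints of HP with superscript hp replaced by as. Synthesis: $M_t^{\text{as,pro}}=f_t^{\text{as,cons}}\eta^{\text{h2a}}$; $M_t^{\text{as,pro}}=P_t^{\text{as,asy}}\eta^{\text{p2a}}$; $P_t^{\text{as,back}}+P_t^{\text{as,buy,rg}}=P_t^{\text{as,asy}}$; $\underline\eta^{\text{asy}}W^{\text{as,asy}}\le M_t^{\text{as,pro}}\le\overline\eta^{\text{asy}}W^{\text{as,asy}}$; $-\underline r^{\text{asy}}W^{\text{as,asy}}\le M_{t+1}^{\text{as,pro}}-M_t^{\text{as,pro}}\le\overline r^{\text{asy}}W^{\text{as,asy}}$; $f_t^{\text{as,buy,hp}}+f_t^{\text{as,hst,out}}=f_t^{\text{as,hst,in}}+f_t^{\text{as,cons}}$. Ammonia storage: $S_{t+1}^{\text{as,ast}}=S_t^{\text{as,ast}}+(M_t^{\text{as,pro}}-M_t^{\text{as,sell}})\Delta t$; $S_{t=0}^{\text{as,ast}}=S_{t=T}^{\text{as,ast}}$;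 $0\le S_t^{\text{as,ast}}\le W^{\text{as,ast}}$; $0\le M_t^{\text{as,sell}}\le\overline M^{\text{as,sell}}$. **Costs.** $C^k=C^k_{\text{inv}}+C^k_{\text{ope}}$. Let $\text{CRF}(r,y)=r(1+r)^y/((1+r)^y-1)$ with discount rate $r>0$ and lifetime $y$ (a constant), and let $\eta_{\text{O\&M}}$ be a constant. For stakeholder $k$, the trading prices in its cost are $\rho_t^{\text{rg-hp,e},k},\rho_t^{\text{rg-as,e},k},\rho_t^{\text{hp-as,h},k}$; they are not components of $\bm{x}^k$. $C^{\text{rg}}_{\text{inv}}=\text{CRF}(r,y)(c^{\text{wt}}W^{\text{rg,wt}}+c^{\text{pv}}W^{\text{rg,pv}}+c^{\text{bes}}W^{\text{rg,bes}}+c^{\text{vc}}W^{\text{rg,vc}}+C^{\text{rg,line}})$, $C^{\text{rg}}_{\text{ope}}=\frac{8760}{T}\sum_{t=1}^T\big(\sigma^{\text{deg}}P_t^{\text{rg,bes,d}}-P_t^{\text{rg,sell,hp}}\rho_t^{\text{rg-hp,e,rg}}-P_t^{\text{rg,sell,as}}\rho_t^{\text{rg-as,e,rg}}\big)\Delta t+\eta_{\text{O\&M}}C^{\text{rg}}_{\text{inv}}$; $C^{\text{hp}}_{\text{inv}}=\text{CRF}(r,y)(c^{\text{ae}}W^{\text{hp,ae}}+c^{\text{hst}}W^{\text{hp,hst}}+c^{\text{bes}}W^{\text{hp,bes}}+C^{\text{hp,pipe}})$, $C^{\text{hp}}_{\text{ope}}=\frac{8760}{T}\sum_{t=1}^T\big(P_t^{\text{hp,buy,rg}}\rho_t^{\text{rg-hp,e,hp}}+\sigma^{\text{deg}}P_t^{\text{hp,bes,d}}-f_t^{\text{hp,sell,as}}\rho_t^{\text{hp-as,h,hp}}\big)\Delta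 t+\eta_{\text{O\&M}}C^{\text{hp}}_{\text{inv}}$; $C^{\text{as}}_{\text{inv}}=\text{CRF}(r,y)(c^{\text{asy}}W^{\text{as,asy}}+c^{\text{ast}}W^{\text{as,ast}}+c^{\text{hst}}W^{\text{as,hst}})$, $C^{\text{as}}_{\text{ope}}=\frac{8760}{T}\sum_{t=1}^T\big(f_t^{\text{as,buy,hp}}\rho_t^{\text{hp-as,h,as}}+P_t^{\text{as,buy,rg}}\rho_t^{\text{rg-as,e,as}}+P_t^{\text{as,back}}\rho_t^{\text{as,back}}-M_t^{\text{as,sell}}\rho_t^{\text{a}}\big)\Delta t+\eta_{\text{O\&M}}C^{\text{as}}_{\text{inv}}$. **Game and equilibrium.** Players are RG, HP, AS; player $k$ chooses $\bm{x}^k\in X^k=\{\bm{x}^k:\bm{h}^k(\bm{x}^k)=\bm{0},\bm{g}^k(\bm{x}^k)\le\bm{0}\}$ to minimize $C^k$, subject also to the coupling constraints. For each player $k$, the coupling constraints have dual variables $\bm{\rho}^{\text{rg-hp,e},k},\bm{\rho}^{\text{rg-as,e},k},\bm{\rho}^{\text{hp-as,h},k}$ (vectors over $t$), which are the same symbols as the prices in $C^k$. The KKT system $\Omega^k$ of player $k$ is $$\nabla_{\bm{x}^k}C^k+(\bm{\lambda}^k)^{\text T}\nabla_{\bm{x}^k}\bm{g}^k+(\bm{\mu}^k)^{\text T}\nabla_{\bm{x}^k}\bm{h}^k+(\bm{\rho}^{\text{rg-hp,e},k})^{\text T}\nabla_{\bm{x}^k}(P^{\text{rg,sell,hp}}-P^{\text{hp,buy,rg}})+(\bm{\rho}^{\text{rg-as,e},k})^{\text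 T}\nabla_{\bm{x}^k}(P^{\text{rg,sell,as}}-P^{\text{as,buy,rg}})+(\bm{\rho}^{\text{hp-as,h},k})^{\text T}\nabla_{\bm{x}^k}(f^{\text{hp,sell,as}}-f^{\text{as,buy,hp}})=\bm{0},$$ together with $(\bm{\lambda}^k)^{\text T}\bm{g}^k=0$, $\bm{\lambda}^k\ge\bm{0}$, $\bm{g}^k\le\bm{0}$, $\bm{h}^k=\bm{0}$, and the coupling constraints. Here $\nabla_{\bm{x}^k}$ differentiates with respect to $\bm{x}^k$ only (prices held fixed); where a norm or absolute value in $\bm{g}^k$ is not differentiable, $\nabla$ stands for some subgradient. An equilibrium is a solution of the joint system $\{\Omega^{\text{rg}},\Omega^{\text{hp}},\Omega^{\text{as}}\}$. It is a **variational equilibrium (VE)** if in addition, for all $k$, $\bm{\rho}^{\text{rg-hp,e},k}=\bm{\rho}^{\text{rg-hp,e}}$, $\bm{\rho}^{\text{rg-as,e},k}=\bm{\rho}^{\text{rg-as,e}}$, $\bm{\rho}^{\text{hp-as,h},k}=\bm{\rho}^{\text{hp-as,h}}$ for common vectors. **Optimal solution with dual variables.** For the single optimization problem in the claim, ''$\bm{x}$ is an optimal solution with associated dual variables $(\bm{\lambda},\bm{\mu},\bm{\rho})$'' means: $\bm{x}$ is a global minimizer of $\sum_kC^k$ over the feasible set, with the prices in every $C^k$ equal to the components of $\bm{\rho}$ held fixed, and $(\bm{\lambda},\bm{\mu},\bm{\rho})$ are KKT multipliers at $\bm{x}$. The latter means $\bm{\lambda}^k\ge\bm{0}$, $(\bm{\lambda}^k)^{\text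 T}\bm{g}^k=0$ for all $k$, and $\partial L/\partial\bm{x}^k=\bm{0}$ for all $k$, where $L=\sum_k\big(C^k+(\bm{\lambda}^k)^{\text T}\bm{g}^k+(\bm{\mu}^k)^{\text T}\bm{h}^k\big)+(\bm{\rho}^{\text{rg-hp,e}})^{\text T}(P^{\text{rg,sell,hp}}-P^{\text{hp,buy,rg}})+(\bm{\rho}^{\text{rg-as,e}})^{\text T}(P^{\text{rg,sell,as}}-P^{\text{as,buy,rg}})+(\bm{\rho}^{\text{hp-as,h}})^{\text T}(f^{\text{hp,sell,as}}-f^{\text{as,buy,hp}})$, with the same conventions on prices held fixed and subgradients. *)

(* Defs.v *)
From HB Require Import structures.
From mathcomp Require Import all_boot all_order all_algebra.
From mathcomp Require Import all_classical all_reals all_analysis.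

Set Implicit Arguments.
Unset Strict Implicit.
Unset Printing Implicit Defensive.

Import Order.TTheory GRing.Theory Num.Theory.
Import numFieldNormedType.Exports.

Local Open Scope ring_scope.

(* States (stored amounts, pipeline pressures and linepack) live on
   t = 0, ..., T; all other quantities on the steps t = 1, ..., T. *)
Definition time (T : nat) : finType := 'I_T.+1.
Definition step (T : nat) : finType := {t : 'I_T.+1 | (0 < t)%N}.

Definition at_end (T : nat) (t : step T) : time T := val t.
Definition at_start (T : nat) (t : step T) : time T := inord (val t).-1.

(* The pairs (t, t + 1) with both t and t + 1 in {1, ..., T}: the range of an
   equation relating t + 1 to t that involves a quantity defined on the steps
   only. *)
Definition consecutive (T : nat) : seq (step T * step T) :=
  [seq s : step T * step T <- enum {: step T * step T} |
     at_end s.2 == (at_end s.1).+1 :> nat].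

(* The end points of the operational horizons: (0, tau), (tau, 2 tau), ... *)
Definition horizons (T tau : nat) : seq (time T * time T) :=
  [seq s : time T * time T <- enum {: time T * time T} |
     (tau %| s.1)%N && (s.2 == s.1 + tau :> nat)%N].

Variant player := RG | HP | AS.

Definition player_seq := [:: RG; HP; AS].
Definition player_code (k : player) : 'I_3 :=
  inord match k with RG => 0 | HP => 1 | AS => 2 end.
Lemma player_codeK : cancel player_code (fun i => nth RG player_seq i).
Proof. by case; rewrite /player_code inordK. Qed.
HB.instance Definition _ := Finite.copy player (can_type player_codeK).

(* Naming: W capacity, P active power, Q reactive power, S stored amount,
   f hydrogen flow, M ammonia flow. *)
Variant rg_qty :=
  | RgWbes | RgWvc
  | RgPbesc | RgPbesd | RgQbes | RgSbes
  | RgPbr | RgQbr | RgLbr          (* branch flows, squared branch current *)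
  | RgVbus | RgPbus | RgQbus       (* squared voltage, injections *)
  | RgPwt | RgPpv | RgPwtcurt | RgPpvcurt | RgQwt | RgQpv | RgQvc
  | RgPsellhp | RgPsellas.

Definition rg_qty_seq :=
  [:: RgWbes; RgWvc; RgPbesc; RgPbesd; RgQbes; RgSbes; RgPbr; RgQbr; RgLbr;
      RgVbus; RgPbus; RgQbus; RgPwt; RgPpv; RgPwtcurt; RgPpvcurt; RgQwt; RgQpv;
      RgQvc; RgPsellhp; RgPsellas].
Definition rg_qty_code (q : rg_qty) : 'I_21 :=
  inord match q with
  | RgWbes => 0 | RgWvc => 1 | RgPbesc => 2 | RgPbesd => 3 | RgQbes => 4
  | RgSbes => 5 | RgPbr => 6 | RgQbr => 7 | RgLbr => 8 | RgVbus => 9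
  | RgPbus => 10 | RgQbus => 11 | RgPwt => 12 | RgPpv => 13 | RgPwtcurt => 14
  | RgPpvcurt => 15 | RgQwt => 16 | RgQpv => 17 | RgQvc => 18 | RgPsellhp => 19
  | RgPsellas => 20 end.
Lemma rg_qty_codeK : cancel rg_qty_code (fun i => nth RgWbes rg_qty_seq i).
Proof. by case; rewrite /rg_qty_code inordK. Qed.
HB.instance Definition _ := Finite.copy rg_qty (can_type rg_qty_codeK).

Variant hp_qty :=
  | HpWae | HpWhst | HpWbes
  | HpPbesc | HpPbesd | HpQbes | HpSbes
  | HpFpro | HpPae | HpPcomp | HpPbuyrg
  | HpShst | HpFin | HpFout        (* hydrogen storage *)
  | HpF | HpFpin | HpFpout         (* pipeline flow, inflow, outflow *)
  | HpPim | HpPin | HpLP           (* nodal pressures, linepack *)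
  | HpFsellas.

Definition hp_qty_seq :=
  [:: HpWae; HpWhst; HpWbes; HpPbesc; HpPbesd; HpQbes; HpSbes; HpFpro; HpPae;
      HpPcomp; HpPbuyrg; HpShst; HpFin; HpFout; HpF; HpFpin; HpFpout; HpPim;
      HpPin; HpLP; HpFsellas].
Definition hp_qty_code (q : hp_qty) : 'I_21 :=
  inord match q with
  | HpWae => 0 | HpWhst => 1 | HpWbes => 2 | HpPbesc => 3 | HpPbesd => 4
  | HpQbes => 5 | HpSbes => 6 | HpFpro => 7 | HpPae => 8 | HpPcomp => 9
  | HpPbuyrg => 10 | HpShst => 11 | HpFin => 12 | HpFout => 13 | HpF => 14
  | HpFpin => 15 | HpFpout => 16 | HpPim => 17 | HpPin => 18 | HpLP => 19
  | HpFsellas => 20 end.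
Lemma hp_qty_codeK : cancel hp_qty_code (fun i => nth HpWae hp_qty_seq i).
Proof. by case; rewrite /hp_qty_code inordK. Qed.
HB.instance Definition _ := Finite.copy hp_qty (can_type hp_qty_codeK).

Variant as_qty :=
  | AsWasy | AsWast | AsWhst
  | AsShst | AsFin | AsFout        (* hydrogen storage *)
  | AsMpro | AsFcons | AsPasy | AsPback | AsPbuyrg | AsFbuyhp
  | AsSast | AsMsell.

Definition as_qty_seq :=
  [:: AsWasy; AsWast; AsWhst; AsShst; AsFin; AsFout; AsMpro; AsFcons; AsPasy;
      AsPback; AsPbuyrg; AsFbuyhp; AsSast; AsMsell].
Definition as_qty_code (q : as_qty) : 'I_14 :=
  inord match q with
  | AsWasy => 0 | AsWast => 1 | AsWhst => 2 | AsShst => 3 | AsFin => 4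
  | AsFout => 5 | AsMpro => 6 | AsFcons => 7 | AsPasy => 8 | AsPback => 9
  | AsPbuyrg => 10 | AsFbuyhp => 11 | AsSast => 12 | AsMsell => 13 end.
Lemma as_qty_codeK : cancel as_qty_code (fun i => nth AsWasy as_qty_seq i).
Proof. by case; rewrite /as_qty_code inordK. Qed.
HB.instance Definition _ := Finite.copy as_qty (can_type as_qty_codeK).

Definition rg_dom (T : nat) (bus branch : finType) (q : rg_qty) : finType :=
  match q with
  | RgWbes | RgWvc => unit
  | RgSbes => time T
  | RgPbr | RgQbr | RgLbr => (branch * step T)%type
  | RgVbus | RgPbus | RgQbus => (bus * step T)%type
  | _ => step T
  end.

Definition hp_dom (T : nat) (q : hp_qty) : finType :=
  match q with
  | HpWae | HpWhst | HpWbes => unit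
  | HpSbes | HpShst | HpPim | HpPin | HpLP => time T
  | _ => step T
  end.

Definition as_dom (T : nat) (q : as_qty) : finType :=
  match q with
  | AsWasy | AsWast | AsWhst => unit
  | AsShst | AsSast => time T
  | _ => step T
  end.

(* The scalar components of x^k: a quantity together with its index. *)
Definition rg_var (T : nat) (bus branch : finType) : finType :=
  {q : rg_qty & rg_dom T bus branch q}.
Definition hp_var (T : nat) : finType := {q : hp_qty & hp_dom T q}.
Definition as_var (T : nat) : finType := {q : as_qty & as_dom T q}.

Definition var (T : nat) (bus branch : finType) (k : player) : finType :=
  match k with
  | RG => rg_var T bus branch
  | HP => hp_var T
  | AS => as_var T
  end.

Notation vec R T bus branch k := ('rV[R]_#|var T bus branch k|).

Definition profile (R : realType) (T : nat) (bus branch : finType) :=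
  forall k : player, vec R T bus branch k.

Definition rg (R : realType) (T : nat) (bus branch : finType)
    (x : vec R T bus branch RG) (q : rg_qty) (i : rg_dom T bus branch q) : R :=
  x 0 (enum_rank (existT (rg_dom T bus branch) q i : rg_var T bus branch)).

Definition hp (R : realType) (T : nat) (bus branch : finType)
    (x : vec R T bus branch HP) (q : hp_qty) (i : hp_dom T q) : R :=
  x 0 (enum_rank (existT (hp_dom T) q i : hp_var T)).

Definition am (R : realType) (T : nat) (bus branch : finType)
    (x : vec R T bus branch AS) (q : as_qty) (i : as_dom T q) : R :=
  x 0 (enum_rank (existT (as_dom T) q i : as_var T)).

Arguments rg {R T bus branch} x q i.
Arguments hp {R T bus branch} x q i.
Arguments am {R T bus branch} x q i.

(* One hydrogen pipeline, from node m to node n. [_lo] and [_hi] are the lower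
   and upper bounds (the barred symbols). *)
Record data (R : realType) (T : nat) (bus branch : finType) := Data {
  dt : R;
  tau : nat;
  src : branch -> bus;
  dst : branch -> bus;
  r_br : branch -> R;
  x_br : branch -> R;
  v_lo : bus -> R;
  v_hi : bus -> R;
  l_hi : branch -> R;
  bus_wt : bus;
  bus_pv : bus;
  bus_bes : bus;
  bus_vc : bus;
  bus_sell_hp : bus;
  bus_sell_as : bus;
  W_wt : R;
  W_pv : R;
  P_wt_max : step T -> R;
  P_pv_max : step T -> R;
  W_rg_bes_lo : R;
  W_rg_bes_hi : R;
  W_rg_vc_lo : R;
  W_rg_vc_hi : R;
  W_hp_ae_lo : R;
  W_hp_ae_hi : R;
  W_hp_hst_lo : R;
  W_hp_hst_hi : R;
  W_hp_bes_lo : R;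
  W_hp_bes_hi : R;
  W_as_asy_lo : R;
  W_as_asy_hi : R;
  W_as_ast_lo : R;
  W_as_ast_hi : R;
  W_as_hst_lo : R;
  W_as_hst_hi : R;
  zeta_bes : R;
  eta_bes_c : R;
  eta_bes_d : R;
  eta_bes_lo : R;
  eta_bes_hi : R;
  eta_p2h : R;
  eta_comp : R;
  eta_ae_lo : R;
  eta_ae_hi : R;
  eta_hst_lo : R;
  eta_hst_hi : R;
  K_gf : R;
  K_lp : R;
  pi_m_lo : R;
  pi_m_hi : R;
  pi_n_lo : R;
  pi_n_hi : R;
  eta_h2a : R;
  eta_p2a : R;
  eta_asy_lo : R;
  eta_asy_hi : R;
  ramp_lo : R;
  ramp_hi : R;
  M_sell_hi : R;
  disc : R;
  life : R;
  eta_om : R;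
  c_wt : R;
  c_pv : R;
  c_bes : R;
  c_vc : R;
  c_ae : R;
  c_hst : R;
  c_asy : R;
  c_ast : R;
  sigma_deg : R;
  C_line : R;
  C_pipe : R;
  price_a : step T -> R;
  price_back : step T -> R
}.

(* Each bus has at most one incoming branch. *)
Definition radial (bus branch : finType) (dst : branch -> bus) : Prop :=
  injective dst.

Record data_ok (R : realType) (T : nat) (bus branch : finType)
    (D : data R T bus branch) : Prop := DataOk {
  T_gt0 : (0 < T)%N;
  tau_gt0 : (0 < tau D)%N;
  tau_dvd : (tau D %| T)%N;
  dt_gt0 : 0 < dt D;
  net_radial : radial (dst D);
  eta_bes_c_gt0 : 0 < eta_bes_c D;
  eta_bes_d_gt0 : 0 < eta_bes_d D;
  eta_p2h_gt0 : 0 < eta_p2h D;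
  eta_comp_gt0 : 0 < eta_comp D;
  eta_h2a_gt0 : 0 < eta_h2a D;
  eta_p2a_gt0 : 0 < eta_p2a D;
  K_gf_gt0 : 0 < K_gf D;
  K_lp_gt0 : 0 < K_lp D;
  pi_m_lo_ge0 : 0 <= pi_m_lo D;
  disc_gt0 : 0 < disc D
}.

(* A constraint vector is a list of real functions: [f] stands for [f x = 0]
   in a list of equalities and for [f x <= 0] in a list of inequalities. *)

(* Euclidean norms: the norm of ['rV[R]_n] in the library is the sup norm. *)
Definition norm2 (R : realType) (a b : R) : R := Num.sqrt (a ^+ 2 + b ^+ 2).
Definition norm3 (R : realType) (a b c : R) : R :=
  Num.sqrt (a ^+ 2 + b ^+ 2 + c ^+ 2).

Definition between (R : realType) (X : Type) (lo f hi : X -> R) :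
    seq (X -> R) :=
  [:: (fun x => lo x - f x); (fun x => f x - hi x)].

Section Common.
Variables (R : realType) (T : nat) (bus branch : finType).
Variable D : data R T bus branch.
Variable X : Type.

Definition bes_eqs (Pc Pd : X -> step T -> R) (S : X -> time T -> R) :
    seq (X -> R) :=
  [seq (fun x => S x (at_end t) -
          ((1 - zeta_bes D) * S x (at_start t) +
           (eta_bes_c D * Pc x t - Pd x t / eta_bes_d D) * dt D))
     | t <- enum (step T)] ++
  [seq (fun x => S x s.1 - S x s.2) | s <- horizons T (tau D)].

Definition bes_ineqs (W : X -> R) (Pc Pd Q : X -> step T -> R)
    (S : X -> time T -> R) : seq (X -> R) :=
  flatten [seq
    [:: (fun x => norm2 (Pc x t) (Q x t) - W x);
        (fun x => norm2 (Pd x t) (Q x t) - W x)] ++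
    between (fun=> 0) (fun x => Pc x t) (fun x => 2^-1 * W x) ++
    between (fun=> 0) (fun x => Pd x t) (fun x => 2^-1 * W x)
    | t <- enum (step T)] ++
  flatten [seq
    between (fun x => eta_bes_lo D * W x) (fun x => S x t)
            (fun x => eta_bes_hi D * W x)
    | t <- enum (time T)].

Definition hst_eqs (Fin Fout : X -> step T -> R) (S : X -> time T -> R) :
    seq (X -> R) :=
  [seq (fun x => S x (at_end s.2) -
          (S x (at_end s.1) + (Fin x s.1 - Fout x s.1) * dt D))
     | s <- consecutive T] ++
  [:: (fun x => S x ord0 - S x ord_max)].

Definition hst_ineqs (W : X -> R) (Fin Fout : X -> step T -> R)
    (S : X -> time T -> R) : seq (X -> R) :=
  flatten [seq
    between (fun x => eta_hst_lo D * W x) (fun x => S x t)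
            (fun x => eta_hst_hi D * W x)
    | t <- enum (time T)] ++
  flatten [seq
    between (fun=> 0) (fun x => Fin x t) (fun x => 2^-1 * W x) ++
    between (fun=> 0) (fun x => Fout x t) (fun x => 2^-1 * W x)
    | t <- enum (step T)].

End Common.

Section Stakeholders.
Variables (R : realType) (T : nat) (bus branch : finType).
Variable D : data R T bus branch.

Notation vec k := (vec R T bus branch k).

(* A quantity located at bus [i], counted at bus [j]. *)
Definition at_bus (i j : bus) (a : R) : R := if i == j then a else 0.

Definition rg_eqs : seq (vec RG -> R) :=
  bes_eqs D (fun x => rg x RgPbesc) (fun x => rg x RgPbesd)
            (fun x => rg x RgSbes) ++
  flatten [seq
    [:: (fun x : vec RG =>
           \sum_(e | src D e == jt.1) rg x RgPbr (e, jt.2) -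
           (rg x RgPbus jt +
            \sum_(e | dst D e == jt.1)
              (rg x RgPbr (e, jt.2) - r_br D e * rg x RgLbr (e, jt.2))));
        (fun x : vec RG =>
           \sum_(e | src D e == jt.1) rg x RgQbr (e, jt.2) -
           (rg x RgQbus jt +
            \sum_(e | dst D e == jt.1)
              (rg x RgQbr (e, jt.2) - x_br D e * rg x RgLbr (e, jt.2))));
        (fun x : vec RG =>
           rg x RgPbus jt -
           (at_bus (bus_wt D) jt.1 (rg x RgPwt jt.2) +
            at_bus (bus_pv D) jt.1 (rg x RgPpv jt.2) +
            at_bus (bus_bes D) jt.1 (rg x RgPbesd jt.2) -
            at_bus (bus_bes D) jt.1 (rg x RgPbesc jt.2) -
            at_bus (bus_sell_hp D) jt.1 (rg x RgPsellhp jt.2) -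
            at_bus (bus_sell_as D) jt.1 (rg x RgPsellas jt.2)));
        (fun x : vec RG =>
           rg x RgQbus jt -
           (at_bus (bus_wt D) jt.1 (rg x RgQwt jt.2) +
            at_bus (bus_pv D) jt.1 (rg x RgQpv jt.2) +
            at_bus (bus_vc D) jt.1 (rg x RgQvc jt.2) +
            at_bus (bus_bes D) jt.1 (rg x RgQbes jt.2)))]
    | jt <- enum {: bus * step T}] ++
  [seq (fun x : vec RG =>
          rg x RgVbus (dst D et.1, et.2) -
          (rg x RgVbus (src D et.1, et.2)
           - 2 * r_br D et.1 * rg x RgPbr et - 2 * x_br D et.1 * rg x RgQbr et
           + (r_br D et.1 ^+ 2 + x_br D et.1 ^+ 2) * rg x RgLbr et))
    | et <- enum {: branch * step T}] ++
  flatten [seq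
    [:: (fun x : vec RG => rg x RgPwt t - (P_wt_max D t - rg x RgPwtcurt t));
        (fun x : vec RG => rg x RgPpv t - (P_pv_max D t - rg x RgPpvcurt t))]
    | t <- enum (step T)].

Definition rg_ineqs : seq (vec RG -> R) :=
  between (fun=> W_rg_bes_lo D) (fun x : vec RG => rg x RgWbes tt)
          (fun=> W_rg_bes_hi D) ++
  between (fun=> W_rg_vc_lo D) (fun x : vec RG => rg x RgWvc tt)
          (fun=> W_rg_vc_hi D) ++
  bes_ineqs D (fun x => rg x RgWbes tt) (fun x => rg x RgPbesc)
            (fun x => rg x RgPbesd) (fun x => rg x RgQbes)
            (fun x => rg x RgSbes) ++
  flatten [seq
    [:: (fun x : vec RG =>
           norm3 (2 * rg x RgPbr et) (2 * rg x RgQbr et)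
                 (rg x RgLbr et - rg x RgVbus (src D et.1, et.2)) -
           (rg x RgLbr et + rg x RgVbus (src D et.1, et.2)));
        (fun x : vec RG => rg x RgLbr et - l_hi D et.1)]
    | et <- enum {: branch * step T}] ++
  flatten [seq
    between (fun=> v_lo D jt.1) (fun x : vec RG => rg x RgVbus jt)
            (fun=> v_hi D jt.1)
    | jt <- enum {: bus * step T}] ++
  flatten [seq
    [:: (fun x : vec RG => norm2 (rg x RgPwt t) (rg x RgQwt t) - W_wt D);
        (fun x : vec RG => norm2 (rg x RgPpv t) (rg x RgQpv t) - W_pv D);
        (fun x : vec RG => `|rg x RgQvc t| - rg x RgWvc tt)]
    | t <- enum (step T)].

Definition hp_eqs : seq (vec HP -> R) :=
  bes_eqs D (fun x => hp x HpPbesc) (fun x => hp x HpPbesd)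
            (fun x => hp x HpSbes) ++
  flatten [seq
    [:: (fun x : vec HP => hp x HpFpro t - hp x HpPae t * eta_p2h D);
        (fun x : vec HP => hp x HpPcomp t - hp x HpFpro t * eta_comp D);
        (fun x : vec HP =>
           hp x HpPbuyrg t + hp x HpPbesd t -
           (hp x HpPbesc t + hp x HpPae t + hp x HpPcomp t));
        (fun x : vec HP => hp x HpF t - (hp x HpFpin t + hp x HpFpout t) / 2);
        (fun x : vec HP =>
           hp x HpFpro t + hp x HpFout t - hp x HpFin t +
           hp x HpFpout t - hp x HpFpin t - hp x HpFsellas t)]
    | t <- enum (step T)] ++
  hst_eqs D (fun x => hp x HpFin) (fun x => hp x HpFout)
            (fun x => hp x HpShst) ++
  [seq (fun x : vec HP =>
          hp x HpLP t - K_lp D * (hp x HpPim t + hp x HpPin t) / 2)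
    | t <- enum (time T)] ++
  [seq (fun x : vec HP =>
          hp x HpLP (at_end s.2) -
          (hp x HpLP (at_end s.1) + hp x HpFpin s.1 - hp x HpFpout s.1))
    | s <- consecutive T] ++
  [seq (fun x : vec HP => hp x HpLP s.1 - hp x HpLP s.2)
    | s <- horizons T (tau D)].

Definition hp_ineqs : seq (vec HP -> R) :=
  between (fun=> W_hp_ae_lo D) (fun x : vec HP => hp x HpWae tt)
          (fun=> W_hp_ae_hi D) ++
  between (fun=> W_hp_hst_lo D) (fun x : vec HP => hp x HpWhst tt)
          (fun=> W_hp_hst_hi D) ++
  between (fun=> W_hp_bes_lo D) (fun x : vec HP => hp x HpWbes tt)
          (fun=> W_hp_bes_hi D) ++
  bes_ineqs D (fun x => hp x HpWbes tt) (fun x => hp x HpPbesc)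
            (fun x => hp x HpPbesd) (fun x => hp x HpQbes)
            (fun x => hp x HpSbes) ++
  hst_ineqs D (fun x => hp x HpWhst tt) (fun x => hp x HpFin)
            (fun x => hp x HpFout) (fun x => hp x HpShst) ++
  flatten [seq
    between (fun x : vec HP => eta_ae_lo D * hp x HpWae tt)
            (fun x => hp x HpPae t)
            (fun x => eta_ae_hi D * hp x HpWae tt) ++
    [:: (fun x : vec HP =>
           (hp x HpF t / K_gf D) ^+ 2 -
           (hp x HpPim (at_end t) ^+ 2 - hp x HpPin (at_end t) ^+ 2));
        (fun x : vec HP => - hp x HpF t)]
    | t <- enum (step T)] ++
  flatten [seq
    between (fun=> pi_m_lo D) (fun x : vec HP => hp x HpPim t)
            (fun=> pi_m_hi D) ++
    between (fun=> pi_n_lo D) (fun x : vec HP => hp x HpPin t)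
            (fun=> pi_n_hi D)
    | t <- enum (time T)].

Definition as_eqs : seq (vec AS -> R) :=
  hst_eqs D (fun x => am x AsFin) (fun x => am x AsFout)
            (fun x => am x AsShst) ++
  flatten [seq
    [:: (fun x : vec AS => am x AsMpro t - am x AsFcons t * eta_h2a D);
        (fun x : vec AS => am x AsMpro t - am x AsPasy t * eta_p2a D);
        (fun x : vec AS =>
           am x AsPback t + am x AsPbuyrg t - am x AsPasy t);
        (fun x : vec AS =>
           am x AsFbuyhp t + am x AsFout t -
           (am x AsFin t + am x AsFcons t))]
    | t <- enum (step T)] ++
  [seq (fun x : vec AS =>
          am x AsSast (at_end s.2) -
          (am x AsSast (at_end s.1) +
           (am x AsMpro s.1 - am x AsMsell s.1) * dt D))
    | s <- consecutive T] ++
  [:: (fun x : vec AS => am x AsSast ord0 - am x AsSast ord_max)].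

Definition as_ineqs : seq (vec AS -> R) :=
  between (fun=> W_as_asy_lo D) (fun x : vec AS => am x AsWasy tt)
          (fun=> W_as_asy_hi D) ++
  between (fun=> W_as_ast_lo D) (fun x : vec AS => am x AsWast tt)
          (fun=> W_as_ast_hi D) ++
  between (fun=> W_as_hst_lo D) (fun x : vec AS => am x AsWhst tt)
          (fun=> W_as_hst_hi D) ++
  hst_ineqs D (fun x => am x AsWhst tt) (fun x => am x AsFin)
            (fun x => am x AsFout) (fun x => am x AsShst) ++
  flatten [seq
    between (fun x : vec AS => eta_asy_lo D * am x AsWasy tt)
            (fun x => am x AsMpro t)
            (fun x => eta_asy_hi D * am x AsWasy tt) ++
    between (fun=> 0) (fun x : vec AS => am x AsMsell t) (fun=> M_sell_hi D)
    | t <- enum (step T)] ++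
  flatten [seq
    between (fun x : vec AS => - ramp_lo D * am x AsWasy tt)
            (fun x => am x AsMpro s.2 - am x AsMpro s.1)
            (fun x => ramp_hi D * am x AsWasy tt)
    | s <- consecutive T] ++
  flatten [seq
    between (fun=> 0) (fun x : vec AS => am x AsSast t)
            (fun x => am x AsWast tt)
    | t <- enum (time T)].

Definition eqs (k : player) : seq (vec k -> R) :=
  match k with RG => rg_eqs | HP => hp_eqs | AS => as_eqs end.

Definition ineqs (k : player) : seq (vec k -> R) :=
  match k with RG => rg_ineqs | HP => hp_ineqs | AS => as_ineqs end.

Definition eq_fun (k : player) (i : 'I_(size (eqs k))) : vec k -> R :=
  tnth (in_tuple (eqs k)) i.

Definition ineq_fun (k : player) (i : 'I_(size (ineqs k))) : vec k -> R :=
  tnth (in_tuple (ineqs k)) i.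

End Stakeholders.

(* The three traded goods: rg-hp electricity, rg-as electricity,
   hp-as hydrogen. *)
Variant good := RgHpE | RgAsE | HpAsH.

Definition good_seq := [:: RgHpE; RgAsE; HpAsH].
Definition good_code (m : good) : 'I_3 :=
  inord match m with RgHpE => 0 | RgAsE => 1 | HpAsH => 2 end.
Lemma good_codeK : cancel good_code (fun i => nth RgHpE good_seq i).
Proof. by case; rewrite /good_code inordK. Qed.
HB.instance Definition _ := Finite.copy good (can_type good_codeK).

Definition prices (R : realType) (T : nat) := good -> step T -> R.

Definition crf (R : realType) (r y : R) : R :=
  r * (1 + r) `^ y / ((1 + r) `^ y - 1).

Section Costs.
Variables (R : realType) (T : nat) (bus branch : finType).
Variable D : data R T bus branch.

Notation vec k := (vec R T bus branch k).
Notation profile := (profile R T bus branch).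

Definition coupling (m : good) (t : step T) (x : profile) : R :=
  match m with
  | RgHpE => rg (x RG) RgPsellhp t - hp (x HP) HpPbuyrg t
  | RgAsE => rg (x RG) RgPsellas t - am (x AS) AsPbuyrg t
  | HpAsH => hp (x HP) HpFsellas t - am (x AS) AsFbuyhp t
  end.

Definition inv_rg (x : vec RG) : R :=
  crf (disc D) (life D) *
  (c_wt D * W_wt D + c_pv D * W_pv D + c_bes D * rg x RgWbes tt +
   c_vc D * rg x RgWvc tt + C_line D).

Definition inv_hp (x : vec HP) : R :=
  crf (disc D) (life D) *
  (c_ae D * hp x HpWae tt + c_hst D * hp x HpWhst tt +
   c_bes D * hp x HpWbes tt + C_pipe D).

Definition inv_as (x : vec AS) : R :=
  crf (disc D) (life D) *
  (c_asy D * am x AsWasy tt + c_ast D * am x AsWast tt +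
   c_hst D * am x AsWhst tt).

Definition ope_rg (p : prices R T) (x : vec RG) : R :=
  8760%:R / T%:R *
  (\sum_(t : step T)
     (sigma_deg D * rg x RgPbesd t - rg x RgPsellhp t * p RgHpE t -
      rg x RgPsellas t * p RgAsE t) * dt D) +
  eta_om D * inv_rg x.

Definition ope_hp (p : prices R T) (x : vec HP) : R :=
  8760%:R / T%:R *
  (\sum_(t : step T)
     (hp x HpPbuyrg t * p RgHpE t + sigma_deg D * hp x HpPbesd t -
      hp x HpFsellas t * p HpAsH t) * dt D) +
  eta_om D * inv_hp x.

Definition ope_as (p : prices R T) (x : vec AS) : R :=
  8760%:R / T%:R *
  (\sum_(t : step T)
     (am x AsFbuyhp t * p HpAsH t + am x AsPbuyrg t * p RgAsE t +
      am x AsPback t * price_back D t - am x AsMsell t * price_a D t) * dt D) +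
  eta_om D * inv_as x.

Definition cost (k : player) (p : prices R T) : vec k -> R :=
  match k with
  | RG => fun x => inv_rg x + ope_rg p x
  | HP => fun x => inv_hp x + ope_hp p x
  | AS => fun x => inv_as x + ope_as p x
  end.

End Costs.

Definition dot (R : realType) (n : nat) (u v : 'rV[R]_n) : R :=
  \sum_i u 0 i * v 0 i.

Definition is_gradient (R : realType) (n : nat) (f : 'rV[R]_n -> R)
    (x v : 'rV[R]_n) : Prop :=
  differentiable f x /\ forall u : 'rV[R]_n, 'd f x u = dot v u.

Definition is_subgradient (R : realType) (n : nat) (f : 'rV[R]_n -> R)
    (x v : 'rV[R]_n) : Prop :=
  forall y : 'rV[R]_n, f x + dot v (y - x) <= f y.

(* The meaning of "v is the nabla of f at x": the gradient where f is
   differentiable, some subgradient where it is not. *)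
Definition nabla (R : realType) (n : nat) (f : 'rV[R]_n -> R)
    (x v : 'rV[R]_n) : Prop :=
  is_gradient f x v \/ (~ differentiable f x /\ is_subgradient f x v).

Section Equilibrium.
Variables (R : realType) (T : nat) (bus branch : finType).
Variable D : data R T bus branch.

Notation vec k := (vec R T bus branch k).
Notation profile := (profile R T bus branch).

Definition ineq_mult := forall k : player, 'I_(size (ineqs D k)) -> R.
Definition eq_mult := forall k : player, 'I_(size (eqs D k)) -> R.

(* [v] is the partial nabla of [F] with respect to x^k, the other players'
   vectors being held fixed; [dfwith x k y] is [x] with x^k
   replaced by [y]. *)
Definition partial_nabla (k : player) (F : profile -> R) (x : profile)
    (v : vec k) : Prop :=
  nabla (fun y : vec k => F (@dfwith player (fun j => vec j) x k y)) (x k) v.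

Definition private_feasible (k : player) (xk : vec k) : Prop :=
  (forall i, eq_fun (D := D) i xk = 0) /\
  (forall i, ineq_fun (D := D) i xk <= 0).

Definition market_clearing (x : profile) : Prop :=
  forall m t, coupling m t x = 0.

Definition feasible (x : profile) : Prop :=
  (forall k, private_feasible (x k)) /\ market_clearing x.

Definition dual_feasible (x : profile) (lam : ineq_mult) (k : player) : Prop :=
  (forall i, 0 <= lam k i) /\
  \sum_i lam k i * ineq_fun i (x k) = 0.

(* Stationarity in Omega^k: the prices [p] are both the data of C^k and the
   multipliers of the coupling constraints. *)
Definition stationary (k : player) (x : profile) (lam : ineq_mult)
    (mu : eq_mult) (p : prices R T) : Prop :=
  exists (c : vec k) (G : 'I_(size (ineqs D k)) -> vec k)
         (H : 'I_(size (eqs D k)) -> vec k) (K : good -> step T -> vec k),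
  [/\ nabla (cost D p) (x k) c,
      forall i, nabla (ineq_fun i) (x k) (G i),
      forall i, nabla (eq_fun i) (x k) (H i),
      forall m t, partial_nabla (coupling m t) x (K m t) &
      c + \sum_i lam k i *: G i + \sum_i mu k i *: H i +
      \sum_m \sum_t p m t *: K m t = 0].

Definition Omega (k : player) (x : profile) (lam : ineq_mult) (mu : eq_mult)
    (p : prices R T) : Prop :=
  [/\ stationary k x lam mu p,
      dual_feasible x lam k,
      private_feasible (x k) &
      market_clearing x].

Definition is_equilibrium (x : profile) (lam : ineq_mult) (mu : eq_mult)
    (p : player -> prices R T) : Prop :=
  forall k, Omega k x lam mu (p k).

Definition is_VE (x : profile) (lam : ineq_mult) (mu : eq_mult)
    (rho : prices R T) : Prop :=
  exists2 p : player -> prices R T,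
    is_equilibrium x lam mu p & forall k m t, p k m t = rho m t.

Definition total_cost (p : prices R T) (x : profile) : R :=
  \sum_k cost D p (x k).

(* The partial derivative with respect to x^k of
     L = sum_j (C^j + lam^j . g^j + mu^j . h^j) + rho . coupling
   vanishes. Since a nabla is a choice of subgradient for each non-smooth
   constraint, it is taken term by term over all the summands of L. *)
Definition dL_zero (k : player) (x : profile) (lam : ineq_mult) (mu : eq_mult)
    (p : prices R T) : Prop :=
  exists (c : player -> vec k)
         (G : forall j, 'I_(size (ineqs D j)) -> vec k)
         (H : forall j, 'I_(size (eqs D j)) -> vec k)
         (K : good -> step T -> vec k),
  [/\ forall j, partial_nabla (fun z => cost D p (z j)) x (c j),
      forall j i, partial_nabla (fun z => ineq_fun i (z j)) x (G j i),
      forall j i, partial_nabla (fun z => eq_fun i (z j)) x (H j i),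
      forall m t, partial_nabla (coupling m t) x (K m t) &
      \sum_j (c j + \sum_i lam j i *: G j i + \sum_i mu j i *: H j i) +
      \sum_m \sum_t p m t *: K m t = 0].

Definition are_KKT_multipliers (x : profile) (lam : ineq_mult) (mu : eq_mult)
    (rho : prices R T) : Prop :=
  (forall k, dual_feasible x lam k) /\ (forall k, dL_zero k x lam mu rho).

Definition is_minimizer (x : profile) (rho : prices R T) : Prop :=
  feasible x /\
  forall y : profile, feasible y -> total_cost rho x <= total_cost rho y.

Definition is_optimal_with_duals (x : profile) (lam : ineq_mult)
    (mu : eq_mult) (rho : prices R T) : Prop :=
  is_minimizer x rho /\ are_KKT_multipliers x lam mu rho.

End Equilibrium.

(* Main.v *)
(* The costs and the equality and coupling constraints are affine, and every
   inequality constraint has a convex sublevel set on the nonnegative pressures,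
   so the feasible set is convex although the Weymouth constraint is not given by
   a convex function. Hence an active inequality has nonpositive derivative
   towards any feasible point, and pairing the stationarity conditions of all
   players with [y k - x k] and summing gives [0 <= total_cost y - total_cost x]:
   common multipliers make the coupling terms cancel. Conversely the terms of the
   Lagrangian that depend on other players only have nabla 0 in [x k], so
   [dL_zero] and [stationary] are the same condition. *)
Require Import Defs.
From mathcomp Require Import all_boot all_order all_algebra.
From mathcomp Require Import all_classical all_reals all_analysis.
From mathcomp Require Import ring lra.

Set Implicit Arguments.
Unset Strict Implicit.
Unset Printing Implicit Defensive.

Import Order.TTheory GRing.Theory Num.Theory.
Import numFieldNormedType.Exports.

Local Open Scope classical_set_scope.
Local Open Scope ring_scope.

(** * Affine and convex functions, and convex sublevel sets *)

Section Affine.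
Variables (R : realType) (V : lmodType R).
Implicit Types (f g : V -> R) (A : V -> Prop).

(** The scalar [s] ranges over all of [R], so the direction [- u] is covered together with [u]. *)
Definition affine f :=
  forall x u s, f (x + s *: u) = f x + s * (f (x + u) - f x).

Definition convex f :=
  forall x u s, 0 <= s <= 1 -> f (x + s *: u) <= f x + s * (f (x + u) - f x).

Definition convex_sublevel A f :=
  forall x u s, A x -> A (x + u) -> 0 <= s <= 1 ->
  f x <= 0 -> f (x + u) <= 0 -> f (x + s *: u) <= 0.

Lemma affine_cst a : affine (fun=> a).
Proof. by move=> x u s; rewrite subrr mulr0 addr0. Qed.

Lemma affineD f g : affine f -> affine g -> affine (fun x => f x + g x).
Proof. by move=> hf hg x u s; rewrite hf hg; ring. Qed.

Lemma affineN f : affine f -> affine (fun x => - f x).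
Proof. by move=> hf x u s; rewrite hf; ring. Qed.

Lemma affineMl a f : affine f -> affine (fun x => a * f x).
Proof. by move=> hf x u s; rewrite hf; ring. Qed.

Lemma affineMr a f : affine f -> affine (fun x => f x * a).
Proof. by move=> hf x u s; rewrite hf; ring. Qed.

Lemma affine_sum (I : finType) (P : pred I) (F : I -> V -> R) :
  (forall i, affine (F i)) -> affine (fun x => \sum_(i | P i) F i x).
Proof.
move=> hF x u s; rewrite -sumrB mulr_sumr -big_split /=.
by apply: eq_bigr => i _; rewrite hF.
Qed.

Lemma affine_at_bus (bus : finType) (i j : bus) f :
  affine f -> affine (fun x => at_bus i j (f x)).
Proof. by rewrite /at_bus; case: (i == j) => // _; exact: affine_cst. Qed.

Lemma affine_convex f : affine f -> convex f.
Proof. by move=> hf x u s _; rewrite hf. Qed.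

Lemma convexB f g : convex f -> affine g -> convex (fun x => f x - g x).
Proof. by move=> hf hg x u s /(hf x u); rewrite hg; lra. Qed.

Lemma convex_norm f : affine f -> convex (fun x => `|f x|).
Proof.
move=> hf x u s /andP[s0 s1]; rewrite hf.
have -> : f x + s * (f (x + u) - f x) = (1 - s) * f x + s * f (x + u) by ring.
apply: le_trans (ler_normD _ _) _.
rewrite !normrM (ger0_norm s0) ger0_norm; lra.
Qed.

Lemma norm3_ge0 (a b c : R) : 0 <= norm3 a b c.
Proof. exact: sqrtr_ge0. Qed.

Lemma norm3_sqr (a b c : R) : norm3 a b c ^+ 2 = a ^+ 2 + b ^+ 2 + c ^+ 2.
Proof. by rewrite sqr_sqrtr // !addr_ge0 // sqr_ge0. Qed.

Lemma norm3Z (s a b c : R) : 0 <= s ->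
  norm3 (s * a) (s * b) (s * c) = s * norm3 a b c.
Proof.
move=> s0; apply/eqP; rewrite -(@eqrXn2 _ 2) ?mulr_ge0 ?norm3_ge0 //.
by rewrite exprMn !norm3_sqr; apply/eqP; ring.
Qed.

(** After squaring, this is the Cauchy-Schwarz inequality. It follows from Lagrange's identity,
    whose three squares are the squared components of the cross product. *)
Lemma norm3_triangle (a b c a' b' c' : R) :
  norm3 (a + a') (b + b') (c + c') <= norm3 a b c + norm3 a' b' c'.
Proof.
rewrite -(@ler_pXn2r _ 2) ?nnegrE ?addr_ge0 ?norm3_ge0 //.
rewrite sqrrD !norm3_sqr.
suff : a * a' + b * b' + c * c' <= norm3 a b c * norm3 a' b' c' by lra.
apply: le_trans (ler_norm _) _.
rewrite -(@ler_pXn2r _ 2) ?nnegrE ?mulr_ge0 ?norm3_ge0 //.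
rewrite real_normK ?num_real // exprMn !norm3_sqr.
have := sqr_ge0 (a * b' - b * a'); have := sqr_ge0 (a * c' - c * a').
have := sqr_ge0 (b * c' - c * b'); lra.
Qed.

Lemma convex_norm3 f g h : affine f -> affine g -> affine h ->
  convex (fun x => norm3 (f x) (g x) (h x)).
Proof.
move=> hf hg hh x u s /andP[s0 s1]; rewrite hf hg hh.
have e a b : a + s * (b - a) = (1 - s) * a + s * b by ring.
rewrite !e; apply: le_trans (norm3_triangle _ _ _ _ _ _) _.
by rewrite !norm3Z ?subr_ge0.
Qed.

Lemma norm2E (a b : R) : norm2 a b = norm3 a b 0.
Proof. by rewrite /norm3 expr0n addr0. Qed.

Lemma convex_norm2 f g : affine f -> affine g ->
  convex (fun x => norm2 (f x) (g x)).
Proof.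
move=> hf hg x u s hs; rewrite !norm2E.
exact: (convex_norm3 hf hg (affine_cst 0)).
Qed.

Lemma convex_convex_sublevel A f : convex f -> convex_sublevel A f.
Proof.
move=> hf x u s _ _ hs fx fxu; apply: le_trans (hf x u s hs) _.
case/andP: hs => s0 s1; nra.
Qed.

(* Where [0 <= h], the nonconvex inequality [f^2 <= h^2 - g^2] is the
   second-order cone constraint [norm2 f g <= h]. *)
Lemma weymouth_convex_sublevel A f g h :
  affine f -> affine g -> affine h -> (forall x, A x -> 0 <= h x) ->
  convex_sublevel A (fun x => f x ^+ 2 - (h x ^+ 2 - g x ^+ 2)).
Proof.
move=> hf hg hh A0.
have soc x : 0 <= h x ->
    (f x ^+ 2 - (h x ^+ 2 - g x ^+ 2) <= 0) = (norm2 (f x) (g x) - h x <= 0).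
  move=> h0; rewrite norm2E [RHS]subr_le0 -(@ler_pXn2r _ 2) ?nnegrE ?norm3_ge0 //.
  by rewrite norm3_sqr -subr_le0; congr (_ <= 0); ring.
move=> x u s Ax Axu hs; have [s0 s1] := andP hs.
have hx := A0 _ Ax; have hxu := A0 _ Axu.
(* Being affine, [h] stays nonnegative on the segment between two points where it is nonnegative. *)
have hs0 : 0 <= h (x + s *: u) by rewrite hh; nra.
rewrite !soc //.
have hc := convexB (convex_norm2 hf hg) hh.
exact: (convex_convex_sublevel (A := fun=> True) hc).
Qed.

End Affine.

(** * Properties shared by all entries of a constraint list *)

Section ForallSeq.
Variables (X : Type) (P : X -> Prop).

Lemma Forall_cat (s1 s2 : seq X) :
  List.Forall P s1 -> List.Forall P s2 -> List.Forall P (s1 ++ s2).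
Proof. by move=> + h2; elim=> //= *; constructor. Qed.

Lemma Forall_mapT (I : Type) (F : I -> X) (s : seq I) :
  (forall i, P (F i)) -> List.Forall P [seq F i | i <- s].
Proof. by move=> hF; elim: s => /= *; constructor. Qed.

Lemma Forall_flatten_mapT (I : Type) (F : I -> seq X) (s : seq I) :
  (forall i, List.Forall P (F i)) -> List.Forall P (flatten [seq F i | i <- s]).
Proof. by move=> hF; elim: s => //= *; exact: Forall_cat. Qed.

Lemma Forall_tnth (s : seq X) (i : 'I_(size s)) :
  List.Forall P s -> P (tnth (in_tuple s) i).
Proof.
(* The entry itself serves as the default of [nth], as [X] has no distinguished element; it is then
   generalised for the induction. *)
move=> h; rewrite (tnth_nth (tnth (in_tuple s) i)) /=.
move: (tnth _ i) => x0; case: i => i /=.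
by elim: h i => //= y l Py _ IH [|i] //; exact: IH.
Qed.

End ForallSeq.

(** * Directional bounds for gradients and subgradients *)

Section Nabla.
Variables (R : realType) (n : nat).
Implicit Types (f : 'rV[R]_n -> R) (x u v w : 'rV[R]_n).

Lemma dotDl u v w : dot (u + v) w = dot u w + dot v w :> R.
Proof.
by rewrite /dot -big_split; apply: eq_bigr => i _; rewrite mxE mulrDl.
Qed.

Lemma dotZl a u w : dot (a *: u) w = a * dot u w :> R.
Proof.
by rewrite /dot mulr_sumr; apply: eq_bigr => i _; rewrite mxE mulrA.
Qed.

Lemma dot0l w : dot 0 w = 0 :> R.
Proof. by rewrite /dot big1 // => i _; rewrite mxE mul0r. Qed.

Lemma dot_suml (I : finType) (F : I -> 'rV[R]_n) w :
  dot (\sum_i F i) w = \sum_i dot (F i) w.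
Proof.
by apply: (big_morph (fun v : 'rV[R]_n => dot v w)) => [u v|]; rewrite ?dotDl ?dot0l.
Qed.

Lemma dotNr u v : dot u (- v) = - dot u v :> R.
Proof.
by rewrite /dot -sumrN; apply: eq_bigr => i _; rewrite mxE mulrN.
Qed.

(** Treats both alternatives of [nabla] at once: a subgradient is tested at [s = 1], a gradient is
    the limit of difference quotients. Only the values on one segment matter, so [f] may be
    nonconvex. *)
Lemma nabla_le f x u v c : nabla f x v ->
  (forall s, 0 <= s <= 1 -> f (x + s *: u) <= f x + s * c) -> dot v u <= c.
Proof.
move=> [[df dv]|[_ sub]] h; last first.
  have := h 1; rewrite scale1r mul1r ler01 lexx => /(_ isT).
  by have := sub (x + u); rewrite (addrC x u) addrK; lra.
rewrite -dv -deriveE //.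
(* The hypothesis speaks of [s >= 0] only, hence the restriction to the one-sided limit. *)
have /cvg_dnbhs_at_right h' : (fun h => h^-1 *: ((f \o shift x) (h *: u) - f x)) @ 0^'
    --> 'D_u f x := diff_derivable (v := u) df.
apply: cvgr_to_le h' _; near=> s.
have s0 : 0 < s by near: s; exact: nbhs_right_gt.
have s1 : s < 1 by near: s; exact: nbhs_right_lt.
rewrite /= (addrC _ x) [_ *: _]mulrC ler_pdivrMr // mulrC lerBlDl.
by apply: h; rewrite !ltW.
Unshelve. all: by end_near. Qed.

(** Two uses of [nabla_le], in the directions [u] and [- u]; no differentiability of affine
    functions has to be established. *)
Lemma nabla_affine f x u v : affine f -> nabla f x v ->
  dot v u = f (x + u) - f x.
Proof.
move=> hf hv; apply/eqP; rewrite eq_le; apply/andP; split.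
  by apply: (nabla_le hv) => s _; rewrite hf.
rewrite -lerN2 -dotNr; apply: (nabla_le hv) => s _.
by rewrite scalerN -scaleNr hf mulrN mulNr.
Qed.

Lemma nabla_cst (a : R) x v : nabla (fun=> a) x v <-> v = 0.
Proof.
split=> [hv|->].
  apply/rowP => i; have := nabla_affine (delta_mx 0 i) (affine_cst _) hv.
  rewrite subrr /dot (bigD1 i) //= big1 => [|j ji]; last first.
    by rewrite mxE (negPf ji) andbF mulr0.
  by rewrite !mxE !eqxx mulr1 addr0.
left; split=> [|u]; first exact: differentiable_cst.
by rewrite (@diff_cst _ _ _ a x) dot0l.
Qed.

End Nabla.

Lemma all_flatten_map (I : finType) (X : Type) (a : pred X) (F : I -> seq X) i :
  all a (flatten [seq F j | j <- enum I]) -> all a (F i).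
Proof.
elim: (enum I) (mem_enum I i) => //= j s IH; rewrite inE all_cat.
by case: eqP => [<- _ /andP[]|_ /IH{}IH /andP[_ /IH]].
Qed.

(** * Affinity and convexity of the stakeholders' constraints and costs *)

Section Constraints.
Variables (R : realType) (T : nat) (bus branch : finType).
Variable D : data R T bus branch.

Notation vec k := (vec R T bus branch k).

Lemma affine_rg (q : rg_qty) (i : rg_dom T bus branch q) :
  affine (fun x : vec RG => rg x q i).
Proof. by move=> x u s; rewrite /rg !mxE; ring. Qed.

Lemma affine_hp (q : hp_qty) (i : hp_dom T q) :
  affine (fun x : vec HP => hp x q i).
Proof. by move=> x u s; rewrite /hp !mxE; ring. Qed.

Lemma affine_am (q : as_qty) (i : as_dom T q) :
  affine (fun x : vec AS => am x q i).
Proof. by move=> x u s; rewrite /am !mxE; ring. Qed.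

Ltac affine_tac :=
  repeat first
    [ exact: affine_cst | exact: affine_rg | exact: affine_hp
    | exact: affine_am | apply: affineD | apply: affineN
    | apply: affineMl | apply: affineMr | apply: affine_at_bus
    | apply: affine_sum => ? ].

Ltac split_constraints :=
  cbv beta;
  repeat first
    [ exact: List.Forall_nil
    | apply: List.Forall_cons
    | apply: Forall_cat
    | apply: Forall_flatten_mapT => ?
    | apply: Forall_mapT => ? ].

Ltac convex_tac :=
  cbv beta;
  first
    [ apply: affine_convex; solve [affine_tac]
    | apply: convexB;
      [ first [apply: convex_norm2 | apply: convex_norm3 | apply: convex_norm]
      | ]; solve [affine_tac] ].

Lemma eqs_affine (k : player) (i : 'I_(size (eqs D k))) : affine (Defs.eq_fun (D := D) i).
Proof.
apply: Forall_tnth; move: i => _; case: k; rewrite /eqs.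
- by rewrite /rg_eqs /bes_eqs; split_constraints; affine_tac.
- by rewrite /hp_eqs /bes_eqs /hst_eqs; split_constraints; affine_tac.
- by rewrite /as_eqs /hst_eqs; split_constraints; affine_tac.
Qed.

(** The pressure at node m bounds the norm in the cone form of the Weymouth inequality, as [h] in
    [weymouth_convex_sublevel]; the pressure at n stays inside the norm. *)
Definition nonneg_pressure (k : player) : vec k -> Prop :=
  match k with
  | HP => fun x => forall t, 0 <= hp x HpPim t
  | _ => fun=> True
  end.

Lemma feasible_nonneg_pressure (hD : data_ok D) (k : player) (x : vec k) :
  private_feasible D x -> nonneg_pressure x.
Proof.
case: k x => //= x [_ hx] t; apply: le_trans (pi_m_lo_ge0 hD) _.
have : all (fun f => f x <= 0) (hp_ineqs D) by apply/(all_tnthP (t := in_tuple _)).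
(* [h] is about the last block of [hp_ineqs], the pressure bounds. *)
rewrite /hp_ineqs !all_cat => /and5P[_ _ _ _ /andP[_ /andP[_ h]]].
by move/(all_flatten_map t): h; rewrite /= subr_le0 => /andP[].
Qed.

(** Except for the Weymouth inequality, every entry is affine, or a Euclidean norm or absolute value
    minus an affine function. *)
Lemma ineqs_convex_sublevel (k : player) (i : 'I_(size (ineqs D k))) :
  convex_sublevel (@nonneg_pressure k) (ineq_fun (D := D) i).
Proof.
apply: Forall_tnth; move: i => _; case: k; rewrite /ineqs.
- rewrite /rg_ineqs /bes_ineqs /between; split_constraints;
    by apply: convex_convex_sublevel; convex_tac.
- rewrite /hp_ineqs /bes_ineqs /hst_ineqs /between; split_constraints;
    try by apply: convex_convex_sublevel; convex_tac.
  apply: weymouth_convex_sublevel; try affine_tac.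
  by move=> x; apply.
- rewrite /as_ineqs /hst_ineqs /between; split_constraints;
    by apply: convex_convex_sublevel; convex_tac.
Qed.

Lemma cost_affine (k : player) (p : prices R T) : affine (@cost R T bus branch D k p).
Proof.
case: k; rewrite /cost /ope_rg /ope_hp /ope_as /inv_rg /inv_hp /inv_as; affine_tac.
Qed.

End Constraints.

Lemma sum_player (R : realType) (F : player -> R) :
  \sum_k F k = F RG + F HP + F AS.
Proof.
rewrite (bigD1 RG) // (bigD1 HP) /=; last exact/eqP.
rewrite (bigD1 AS) /=; last by apply/andP; split; apply/eqP.
by rewrite big1 ?addr0 ?addrA //; case; rewrite !eqxx ?andbF.
Qed.

(** * From stationarity of all players to joint optimality *)

Section Equilibrium.
Variables (R : realType) (T : nat) (bus branch : finType).
Variable D : data R T bus branch.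

Notation vec k := (vec R T bus branch k).
Notation profile := (profile R T bus branch).
Notation deviate x y := (@dfwith player (fun j => vec j) x _ y).
Implicit Types (x y : profile) (p rho : prices R T).

Lemma deviate_id x k : deviate x (x k) = x.
Proof. by apply: functional_extensionality_dep => j; case: dfwithP. Qed.

Lemma partial_nabla_own k (F : vec k -> R) x (v : vec k) :
  partial_nabla (fun z => F (z k)) x v <-> nabla F (x k) v.
Proof.
rewrite /partial_nabla.
by under [X in nabla X]funext => y do rewrite dfwithin.
Qed.

Lemma partial_nabla_other k j (kj : k != j) (F : vec j -> R) x (v : vec k) :
  partial_nabla (fun z => F (z j)) x v <-> v = 0.
Proof.
rewrite /partial_nabla.
under [X in nabla X]funext => y do rewrite dfwithout //.
exact: nabla_cst.
Qed.

Lemma dL_zero_stationary k x lam mu p :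
  @dL_zero R T bus branch D k x lam mu p <-> stationary k x lam mu p.
Proof.
split=> [[c [G [H [K [hc hG hH hK e]]]]]|[c [G [H [K [hc hG hH hK e]]]]]].
  exists (c k), (G k), (H k), K; split=> //.
  - exact/partial_nabla_own.
  - by move=> i; apply/partial_nabla_own.
  - by move=> i; apply/partial_nabla_own.
  - rewrite -[RHS]e; congr (_ + _); rewrite (bigD1 k) //=.
    rewrite [X in _ = _ + X]big1 ?addr0 // => j jk.
    have kj : k != j by rewrite eq_sym.
    have -> := (partial_nabla_other kj (cost D p (k := j)) x _).1 (hc j).
    rewrite !big1 ?addr0 // => i _.
      by have -> := (partial_nabla_other kj (Defs.eq_fun (D := D) i) x _).1 (hH j i); rewrite scaler0.
    by have -> := (partial_nabla_other kj (ineq_fun (D := D) i) x _).1 (hG j i); rewrite scaler0.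
(* The summands of player [k] keep the given nablas; those of the others, constant in the vector of
   [k], get 0. *)
pose c' := @dfwith player (fun=> vec k) (fun=> 0) k c.
pose G' := @dfwith player (fun j => 'I_(size (ineqs D j)) -> vec k)
  (fun _ _ => 0) k G.
pose H' := @dfwith player (fun j => 'I_(size (eqs D j)) -> vec k)
  (fun _ _ => 0) k H.
exists c', G', H', K; split=> //.
- move=> j; rewrite /c'; case: dfwithP => [|{}j kj].
    exact/partial_nabla_own.
  exact/partial_nabla_other.
- move=> j; rewrite /G'; case: dfwithP => [|{}j kj] i.
    exact/partial_nabla_own.
  exact/partial_nabla_other.
- move=> j; rewrite /H'; case: dfwithP => [|{}j kj] i.
    exact/partial_nabla_own.
  exact/partial_nabla_other.
- rewrite -[RHS]e; congr (_ + _); rewrite (bigD1 k) //= /c' /G' /H' !dfwithin.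
  rewrite [X in _ + X = _]big1 ?addr0 // => j jk.
  rewrite !dfwithout 1?eq_sym // add0r.
  by rewrite !big1 ?addr0 // => i _; rewrite scaler0.
Qed.

Lemma coupling_affine k x m t :
  affine (fun y : vec k => coupling m t (deviate x y)).
Proof.
have comp j (F : vec j -> R) : affine F ->
    affine (fun y : vec k => F (deviate x y j)).
  case: (eqVneq k j) => [kj|kj].
    subst j => hF.
    by under [X in affine X]funext => y do rewrite dfwithin.
  move=> _; under [X in affine X]funext => y do rewrite dfwithout //.
  exact: affine_cst.
case: m; apply: affineD; try apply: affineN.
- exact: (comp RG _ (affine_rg _)).
- exact: (comp HP _ (affine_hp _)).
- exact: (comp RG _ (affine_rg _)).
- exact: (comp AS _ (affine_am _)).
- exact: (comp HP _ (affine_hp _)).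
- exact: (comp AS _ (affine_am _)).
Qed.

(** Each coupling function is a difference of two terms owned by different players, so the effects
    of unilateral deviations add up to that of the joint one. *)
Lemma sum_coupling_deviate x y m t :
  \sum_k (coupling m t (deviate x (y k)) - coupling m t x) =
  coupling m t y - coupling m t x.
Proof.
rewrite sum_player; case: m; rewrite /coupling;
  rewrite !dfwithin ?dfwithout; try exact/eqP; ring.
Qed.

Lemma sum_player_coupling_nabla x y rho
    (K : forall k, good -> step T -> vec k) :
  (forall k m t, partial_nabla (coupling m t) x (K k m t)) ->
  market_clearing x -> market_clearing y ->
  \sum_k dot (\sum_m \sum_t rho m t *: K k m t) (y k - x k) = 0.
Proof.
move=> hK cx cy.
have dotK k m t : dot (K k m t) (y k - x k) =
    coupling m t (deviate x (y k)) - coupling m t x.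
  rewrite (nabla_affine _ (coupling_affine x m t) (hK k m t)).
  by rewrite (addrC (x k)) subrK deviate_id.
under eq_bigr => k _.
  rewrite dot_suml; under eq_bigr => m _.
    rewrite dot_suml; under eq_bigr => t _ do rewrite dotZl dotK.
    over.
  over.
(* Since [rho] is common to the players, it factors out once the sum over players is innermost. *)
rewrite exchange_big big1 // => m _; rewrite exchange_big big1 // => t _.
by rewrite -mulr_sumr sum_coupling_deviate cx cy subrr mulr0.
Qed.

Lemma ineq_nabla_le0 (hD : data_ok D) k (xk yk : vec k) i (v : vec k) :
  private_feasible D xk -> private_feasible D yk ->
  ineq_fun (D := D) i xk = 0 -> nabla (ineq_fun (D := D) i) xk v ->
  dot v (yk - xk) <= 0.
Proof.
move=> fx fy gx0 hv; apply: (nabla_le hv) => s hs.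
(* [nabla_le] is used with [c = 0]: the constraint is active at [xk] and stays nonpositive up to
   [yk]. *)
rewrite gx0 add0r mulr0.
have e : xk + (yk - xk) = yk by rewrite addrC subrK.
apply: ineqs_convex_sublevel => //; rewrite ?e.
- exact: feasible_nonneg_pressure hD _ _ fx.
- exact: feasible_nonneg_pressure hD _ _ fy.
- exact: fx.2.
- exact: fy.2.
Qed.

Lemma dual_feasible_compl x (lam : ineq_mult D) k i : dual_feasible x lam k ->
  private_feasible D (x k) -> lam k i = 0 \/ ineq_fun (D := D) i (x k) = 0.
Proof.
move=> [lam0 compl] [_ gx].
(* All products are nonpositive; negating them allows [psumr_eq0] to make each one vanish. *)
have h : \sum_i - (lam k i * ineq_fun i (x k)) == 0 by rewrite sumrN compl oppr0.
move: h; rewrite psumr_eq0 => [/allP /(_ i)|j _]; last first.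
  by rewrite oppr_ge0 mulr_ge0_le0.
rewrite mem_index_enum oppr_eq0 mulf_eq0 => /(_ isT) /orP[] /eqP; tauto.
Qed.

Lemma stationary_minimizer (hD : data_ok D) x (lam : ineq_mult D)
    (mu : eq_mult D) rho :
  (forall k, stationary k x lam mu rho) ->
  (forall k, dual_feasible x lam k) -> feasible D x ->
  is_minimizer D x rho.
Proof.
move=> st df fx; split=> // y fy.
(* Each player's stationarity is paired with [y k - x k], keeping only the cost and coupling terms.
   The sigma type lets the [K] of all players be chosen together before summing. *)
have {st} /all_sig2 : forall k, {K : good -> step T -> vec k |
    (forall m t, partial_nabla (coupling m t) x (K m t)) &
    0 <= cost D rho (y k) - cost D rho (x k) +
         dot (\sum_m \sum_t rho m t *: K m t) (y k - x k)}.
  move=> k; apply: cid2; have [c [G [H [K [hc hG hH hK e]]]]] := st k.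
  exists K => //.
  have yk : x k + (y k - x k) = y k by rewrite addrC subrK.
  have := congr1 (fun v => dot v (y k - x k)) e.
  rewrite !dotDl dot0l !dot_suml.
  rewrite (nabla_affine _ (cost_affine D rho) hc) yk.
  rewrite [X in _ + X + _ = _ -> _]big1 => [|i _]; last first.
    rewrite dotZl (nabla_affine _ (eqs_affine _) (hH i)) yk.
    by rewrite (fx.1 k).1 (fy.1 k).1 subrr mulr0.
  have : \sum_i dot (lam k i *: G i) (y k - x k) <= 0.
    apply: sumr_le0 => i _; rewrite dotZl.
    have [->|gx] := dual_feasible_compl i (df k) (fx.1 k); first by rewrite mul0r.
    apply: mulr_ge0_le0; first exact: (df k).1.
    exact: (ineq_nabla_le0 hD (fx.1 k) (fy.1 k) gx (hG i)).
  lra.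
move=> [K hK hle].
have : 0 <= \sum_k (cost D rho (y k) - cost D rho (x k) +
    dot (\sum_m \sum_t rho m t *: K k m t) (y k - x k)).
  by apply: sumr_ge0 => k _; exact: hle.
rewrite big_split /= (sum_player_coupling_nabla _ hK fx.2 fy.2) addr0 sumrB.
by rewrite subr_ge0.
Qed.

End Equilibrium.

Theorem theorem1 (R : realType) (T : nat) (bus branch : finType)
    (D : data R T bus branch) (hD : data_ok D)
    (x : profile R T bus branch) (lam : ineq_mult D) (mu : eq_mult D)
    (rho : prices R T) :
  is_VE x lam mu rho <-> is_optimal_with_duals x lam mu rho.
Proof.
split=> [[p eqx prho]|[[fx _] [df dL]]].
  have {prho} pE k : p k = rho by apply/funext => m; apply/funext => t.
  have st k : stationary k x lam mu rho by have [] := eqx k; rewrite pE.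
  have df k : dual_feasible x lam k by have [] := eqx k.
  split; last by split=> // k; apply/dL_zero_stationary.
  apply: (stationary_minimizer hD st df).
  (* Market clearing occurs in the system of every player; the copy of [RG] is taken. *)
  by split=> [k|]; [have [] := eqx k | have [] := eqx RG].
exists (fun=> rho) => // k; split=> //; last exact: fx.2.
- exact/dL_zero_stationary.
- exact: fx.1.
Qed.
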